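(* Let $M \models \mathbf{PA}^-$ and $n \geq 0$. The following are equivalent: 1. $M \models \mathbf{Coll}^{\mathrm{d}}(\Sigma_{n+1})$. 2. $M \models \mathbf{Coll}^-(\Sigma_{n+1})$. 3. $M$ satisfies the conditions $\mathsf{end}_{n}$ and $\mathsf{COF}_{n+2}^{<}$. 4. $M$ satisfies the conditions $\mathsf{end}_{n}$ and $\mathsf{cof}_{n+2}^{<}$.
   Context: $\mathcal{L}_A=\{0,1,+,\times,<\}$ is the language of first-order arithmetic, and $\mathbf{PA}^-$ is the $\mathcal{L}_A$-theory of the non-negative parts of commutative discretely ordered rings. $\Delta_0=\Sigma_0=\Pi_0$ is the class of $\mathcal{L}_A$-formulas all of whose quantifiers are bounded; $\Sigma_{n+1}$ (resp. $\Pi_{n+1}$) formulas are those of the form $\exists \vec{y}\,\varphi$ with $\varphi\in\Pi_n$ (resp. $\forall \vec{y}\,\varphi$ with $\varphi\in\Sigma_n$), where $\vec{y}$ is a finite, possibly empty, tuple. Vector notation denotes finite (possibly empty) tuples of variables or elements; for tuples of the same length, $\vec{x}<\vec{u}$ means $x_i<u_i$ for every $i$. $M\subseteq N$ means $M$ is a substructure of $N$; $M\prec N$ means $N$ is an elementary extension of $M$; $M\prec_\Gamma N$ means $M\subseteq N$ and for every $\vec{a}\in M$ and every $\varphi(\vec{x})\in\Gamma$, $M\models\varphi(\vec{a})$ iff $N\models\varphi(\vec{a})$. For $M\subseteq K$ and $k\geq 0$, $M\prec_{\Sigma_{k+1}}^{<}K$ means that for every $\vec{a}\in M$ and every $\Pi_k$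 formula $\varphi(\vec{x})$ (with no free variables other than $\vec{x}$), $M\models\exists\vec{x}<\vec{a}\,\varphi(\vec{x})$ iff $K\models\exists\vec{x}<\vec{a}\,\varphi(\vec{x})$. $K$ is a cofinal extension of $M$ iff $M\subseteq K$ and for every $a\in K$ there is $b\in M$ with $K\models a<b$. For $M,N\models\mathbf{PA}^-$ with $M\subseteq N$, $\sup_N(M):=\{a\in N\mid \exists b\in M\ (N\models a\leq b)\}$, regarded as a substructure of $N$ (it is again a model of $\mathbf{PA}^-$). $\mathbf{Coll}^{\mathrm{d}}(\Gamma)$ is the scheme $\forall \vec{u}\,(\forall \vec{z}\,\forall \vec{x}<\vec{u}\,\exists \vec{y}\,\varphi(\vec{x},\vec{y},\vec{z})\to\forall \vec{z}\,\exists \vec{v}\,\forall \vec{x}<\vec{u}\,\exists \vec{y}<\vec{v}\,\varphi(\vec{x},\vec{y},\vec{z}))$ for $\varphi\in\Gamma$. $\mathbf{Coll}^-(\Gamma)$ is the scheme $\forall \vec{u}\,(\forall \vec{x}<\vec{u}\,\exists \vec{y}\,\varphi(\vec{x},\vec{y})\to\exists \vec{v}\,\forall \vec{x}<\vec{u}\,\exists \vec{y}<\vec{v}\,\varphi(\vec{x},\vec{y}))$ for $\varphi\in\Gamma$ (with no free variables other than $\vec{x},\vec{y}$). For $M\models\mathbf{PA}^-$ and $k\geq 0$: $M$ satisfies $\mathsf{end}_k$ iff for every $N\models\mathbf{PA}^-$ with $M\prec N$, $\sup_N(M)\prec_{\Sigma_k}N$; $M$ satisfies $\mathsf{cof}_{k+1}^{<}$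 iff for every $N\models\mathbf{PA}^-$ with $M\prec N$, $M\prec_{\Sigma_{k+1}}^{<}\sup_N(M)$; $M$ satisfies $\mathsf{COF}_{k+1}^{<}$ iff for every $K\models\mathbf{PA}^-$ such that $M\prec_{\Delta_0}K$ and $K$ is a cofinal extension of $M$, $M\prec_{\Sigma_{k+1}}^{<}K$. *)

(* Defs.v *)
From mathcomp Require Import all_boot.
From Stdlib Require List Classical_Prop.

Set Implicit Arguments.
Unset Strict Implicit.
Unset Printing Implicit Defensive.

(** * First-order arithmetic: syntax

    [formula V] is the type of formulas whose free variables lie in [V].
    A quantifier binds the variable [None] of [option V]; the variables of [V]
    become [Some v] in its scope.  A formula phi(x) in a tuple x of length d is
    a [formula 'I_d], and phi(x, y) is a [formula ('I_a + 'I_b)]. *)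

Inductive term (V : Type) : Type :=
| Var of V
| Zero
| One
| Add of term V & term V
| Mul of term V & term V.

Arguments Zero {V}.
Arguments One {V}.

Fixpoint tmap (V W : Type) (f : V -> W) (t : term V) : term W :=
  match t with
  | Var v => Var (f v)
  | Zero => Zero
  | One => One
  | Add s t => Add (tmap f s) (tmap f t)
  | Mul s t => Mul (tmap f s) (tmap f t)
  end.

Inductive formula (V : Type) : Type :=
| Eq of term V & term V
| Lt of term V & term V
| Not of formula V
| And of formula V & formula V
| Or of formula V & formula V
| Imp of formula V & formula V
| All of formula (option V)
| Ex of formula (option V).

(** The bound [t] is a term over [V], so it cannot mention the bound variable. *)

Definition BAll (V : Type) (t : term V) (phi : formula (option V)) : formula V :=
  All (Imp (Lt (Var None) (tmap Some t)) phi).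

Definition BEx (V : Type) (t : term V) (phi : formula (option V)) : formula V :=
  Ex (And (Lt (Var None) (tmap Some t)) phi).

(** * The arithmetical hierarchy *)

Definition fclass := forall V : Type, formula V -> Prop.

Inductive Delta0 (V : Type) : formula V -> Prop :=
| Delta0_Eq s t : Delta0 (Eq s t)
| Delta0_Lt s t : Delta0 (Lt s t)
| Delta0_Not phi : Delta0 phi -> Delta0 (Not phi)
| Delta0_And phi psi : Delta0 phi -> Delta0 psi -> Delta0 (And phi psi)
| Delta0_Or phi psi : Delta0 phi -> Delta0 psi -> Delta0 (Or phi psi)
| Delta0_Imp phi psi : Delta0 phi -> Delta0 psi -> Delta0 (Imp phi psi)
| Delta0_BAll t (phi : formula (option V)) : Delta0 phi -> Delta0 (BAll t phi)
| Delta0_BEx t (phi : formula (option V)) : Delta0 phi -> Delta0 (BEx t phi).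

(** [Sigma n.+1] consists of the formulas obtained from [Pi n] formulas by
    prefixing a finite, possibly empty, block of existential quantifiers. *)

Inductive Sigma : nat -> fclass :=
| Sigma_Delta0 V (phi : formula V) : Delta0 phi -> Sigma 0 phi
| Sigma_Pi n V (phi : formula V) : Pi n phi -> Sigma n.+1 phi
| Sigma_Ex n V (phi : formula (option V)) :
    Sigma n.+1 phi -> Sigma n.+1 (Ex phi)
with Pi : nat -> fclass :=
| Pi_Delta0 V (phi : formula V) : Delta0 phi -> Pi 0 phi
| Pi_Sigma n V (phi : formula V) : Sigma n phi -> Pi n.+1 phi
| Pi_All n V (phi : formula (option V)) :
    Pi n.+1 phi -> Pi n.+1 (All phi).

(** * Structures and satisfaction *)

Record structure := Structure {
  carrier :> Type;
  zero : carrier;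
  one : carrier;
  add : carrier -> carrier -> carrier;
  mul : carrier -> carrier -> carrier;
  lt : carrier -> carrier -> Prop
}.

Arguments zero : clear implicits.
Arguments one : clear implicits.

Definition le (M : structure) (a b : M) : Prop := lt a b \/ a = b.

Definition tuple_lt (M : structure) (I : Type) (x u : I -> M) : Prop :=
  forall i, lt (x i) (u i).

Definition scons (A V : Type) (a : A) (e : V -> A) : option V -> A :=
  fun o => if o is Some v then e v else a.

Definition scat (A V W : Type) (e : V -> A) (f : W -> A) : V + W -> A :=
  fun s => match s with inl v => e v | inr w => f w end.

Fixpoint eval (M : structure) (V : Type) (e : V -> M) (t : term V) : M :=
  match t with
  | Var v => e v
  | Zero => zero M
  | One => one M
  | Add s t => add (eval e s) (eval e t)
  | Mul s t => mul (eval e s) (eval e t)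
  end.

Fixpoint sat (M : structure) (V : Type) (phi : formula V) (e : V -> M)
    {struct phi} : Prop :=
  match phi in formula _ with
  | Eq s t => eval e s = eval e t
  | Lt s t => lt (eval e s) (eval e t)
  | Not p => ~ sat p e
  | And p q => sat p e /\ sat q e
  | Or p q => sat p e \/ sat q e
  | Imp p q => sat p e -> sat q e
  | All p => forall a : M, sat p (scons a e)
  | Ex p => exists a : M, sat p (scons a e)
  end.

(** * The theory PA^-

    Kaye's axioms for the non-negative parts of commutative discretely ordered
    rings, written with free variables 0, 1, 2 (x, y, z below) that are
    understood to be universally quantified. *)

Definition PAminus_axioms : seq (formula nat) :=
  let x := Var 0 in let y := Var 1 in let z := Var 2 in
  [:: Eq (Add (Add x y) z) (Add x (Add y z));
      Eq (Add x y) (Add y x);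
      Eq (Mul (Mul x y) z) (Mul x (Mul y z));
      Eq (Mul x y) (Mul y x);
      Eq (Mul x (Add y z)) (Add (Mul x y) (Mul x z));
      And (Eq (Add x Zero) x) (Eq (Mul x Zero) Zero);
      Eq (Mul x One) x;
      Imp (And (Lt x y) (Lt y z)) (Lt x z);
      Not (Lt x x);
      Or (Lt x y) (Or (Eq x y) (Lt y x));
      Imp (Lt x y) (Lt (Add x z) (Add y z));
      Imp (And (Lt Zero z) (Lt x y)) (Lt (Mul x z) (Mul y z));
      Imp (Lt x y) (Ex (Eq (Add (tmap Some x) (Var None)) (tmap Some y)));
      And (Lt Zero One) (Imp (Lt Zero x) (Or (Lt One x) (Eq One x)));
      Or (Lt Zero x) (Eq Zero x)].

Definition PAminus (M : structure) : Prop :=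
  forall phi, List.In phi PAminus_axioms -> forall e : nat -> M, sat phi e.

(** * Extensions

    [M] being a substructure of [N] is rendered by an embedding of [M] in [N]. *)

Record embedding (M N : structure) := Embedding {
  emb :> M -> N;
  emb_inj : injective emb;
  emb_zero : emb (zero M) = zero N;
  emb_one : emb (one M) = one N;
  emb_add : forall a b, emb (add a b) = add (emb a) (emb b);
  emb_mul : forall a b, emb (mul a b) = mul (emb a) (emb b);
  emb_lt : forall a b, lt a b <-> lt (emb a) (emb b)
}.

Definition prec (G : fclass) (M N : structure) (j : embedding M N) : Prop :=
  forall (d : nat) (phi : formula 'I_d), G _ phi ->
  forall a : 'I_d -> M, sat phi a <-> sat phi (j \o a).

Definition elementary (M N : structure) (j : embedding M N) : Prop :=
  prec (fun _ _ => True) j.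

(** [prec_bSigmaS k j] is the relation with subscript Sigma_{k+1} and
    superscript <, on existential formulas whose leading block is bounded by
    elements of [M] and whose matrix is [Pi k]. *)

Definition prec_bSigmaS (k : nat) (M K : structure) (j : embedding M K) : Prop :=
  forall (d : nat) (phi : formula 'I_d), Pi k phi ->
  forall a : 'I_d -> M,
    (exists x : 'I_d -> M, tuple_lt x a /\ sat phi x) <->
    (exists x : 'I_d -> K, tuple_lt x (j \o a) /\ sat phi x).

Definition cofinal (M K : structure) (j : embedding M K) : Prop :=
  forall a : K, exists b : M, lt a (j b).

(** * The substructure sup_N(M) *)

Section Sup.

Variables (M N : structure) (j : embedding M N) (HN : PAminus N).

Definition in_sup (a : N) : Prop := exists b : M, le a (j b).

Let env (a b c : N) : nat -> N := nth c [:: a; b].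

Lemma in_sup_emb (b : M) : in_sup (j b).
Proof. by exists b; right. Qed.

Lemma in_sup_zero : in_sup (zero N).
Proof. by rewrite -(emb_zero j); apply: in_sup_emb. Qed.

Lemma in_sup_one : in_sup (one N).
Proof. by rewrite -(emb_one j); apply: in_sup_emb. Qed.

Lemma PAminus_nth (i : nat) (a b c : N) :
  sat (nth (Eq Zero Zero) PAminus_axioms i) (env a b c).
Proof.
have [lt_i|le_i] := ltnP i (size PAminus_axioms); last by rewrite nth_default.
apply: HN; elim: PAminus_axioms i lt_i => //= phi s IHs [|i] lt_i; first by left.
by right; apply: IHs.
Qed.

Lemma PAminus_le_trans (a b c : N) : le a b -> le b c -> le a c.
Proof.
case=> [lt_ab|->] // [lt_bc|<-]; last by left.
by left; apply: (PAminus_nth 7 a b c); split.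
Qed.

Lemma PAminus_le_add (a b c d : N) : le a b -> le c d -> le (add a c) (add b d).
Proof.
have addC (x y : N) : add x y = add y x by exact: (PAminus_nth 1 x y x).
have leD (x y z : N) : le x y -> le (add x z) (add y z).
  case=> [lt_xy|->]; last by right.
  by left; move: lt_xy; exact: (PAminus_nth 10 x y z).
move=> le_ab le_cd; apply: (PAminus_le_trans (leD _ _ c le_ab)).
by rewrite (addC b c) (addC b d); apply: leD.
Qed.

Lemma PAminus_le_mul (a b c d : N) : le a b -> le c d -> le (mul a c) (mul b d).
Proof.
have mulC (x y : N) : mul x y = mul y x by exact: (PAminus_nth 3 x y x).
have mul0 (x : N) : mul x (zero N) = zero N by case: (PAminus_nth 5 x x x).
have ge0 (x : N) : lt (zero N) x \/ zero N = x by exact: (PAminus_nth 14 x x x).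
have leM (x y z : N) : le x y -> le (mul x z) (mul y z).
  case=> [lt_xy|->]; last by right.
  case: (ge0 z) => [z_gt0|<-]; last by rewrite !mul0; right.
  by left; have /= := PAminus_nth 11 x y z; apply.
move=> le_ab le_cd; apply: (PAminus_le_trans (leM _ _ c le_ab)).
by rewrite (mulC b c) (mulC b d); apply: leM.
Qed.

Lemma in_sup_add (a b : N) : in_sup a -> in_sup b -> in_sup (add a b).
Proof.
move=> [c le_ac] [d le_bd]; exists (add c d).
by rewrite emb_add; apply: PAminus_le_add.
Qed.

Lemma in_sup_mul (a b : N) : in_sup a -> in_sup b -> in_sup (mul a b).
Proof.
move=> [c le_ac] [d le_bd]; exists (mul c d).
by rewrite emb_mul; apply: PAminus_le_mul.
Qed.

Definition sup : structure := {|
  carrier := {a : N | in_sup a};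
  zero := exist _ (zero N) in_sup_zero;
  one := exist _ (one N) in_sup_one;
  add a b := exist _ (add (sval a) (sval b)) (in_sup_add (svalP a) (svalP b));
  mul a b := exist _ (mul (sval a) (sval b)) (in_sup_mul (svalP a) (svalP b));
  lt a b := lt (sval a) (sval b)
|}.

Lemma sup_val_inj : injective (fun a : sup => sval a : N).
Proof.
move=> [a Pa] [b Pb] /= eq_ab; case: _ / eq_ab Pb => Pb.
by rewrite (Classical_Prop.proof_irrelevance _ Pa Pb).
Qed.

Definition sup_incl : embedding sup N.
Proof. by exists (fun a : sup => sval a); first exact: sup_val_inj. Defined.

Definition sup_emb : embedding M sup.
Proof.
exists (fun b => exist _ (j b) (in_sup_emb b) : sup).
- by move=> a b /(congr1 (fun c : sup => sval c)) /= /emb_inj.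
- exact/sup_val_inj/emb_zero.
- exact/sup_val_inj/emb_one.
- by move=> a b; apply/sup_val_inj/emb_add.
- by move=> a b; apply/sup_val_inj/emb_mul.
- by move=> a b; apply: emb_lt.
Defined.

End Sup.

(** * Collection schemes

    [scat (scat x y) z] is the assignment of the tuples x, y, z to the
    three groups of free variables of phi(x, y, z). *)

Definition Colld (G : fclass) (M : structure) : Prop :=
  forall (a b c : nat) (phi : formula ('I_a + 'I_b + 'I_c)), G _ phi ->
  forall u : 'I_a -> M,
    (forall (z : 'I_c -> M) (x : 'I_a -> M), tuple_lt x u ->
       exists y : 'I_b -> M, sat phi (scat (scat x y) z)) ->
    forall z : 'I_c -> M, exists v : 'I_b -> M,
      forall x : 'I_a -> M, tuple_lt x u ->
        exists y : 'I_b -> M, tuple_lt y v /\ sat phi (scat (scat x y) z).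

Definition Collminus (G : fclass) (M : structure) : Prop :=
  forall (a b : nat) (phi : formula ('I_a + 'I_b)), G _ phi ->
  forall u : 'I_a -> M,
    (forall x : 'I_a -> M, tuple_lt x u ->
       exists y : 'I_b -> M, sat phi (scat x y)) ->
    exists v : 'I_b -> M,
      forall x : 'I_a -> M, tuple_lt x u ->
        exists y : 'I_b -> M, tuple_lt y v /\ sat phi (scat x y).

(** * The conditions end_k, cof^<_{k+1} and COF^<_{k+1}

    The last two are [cof_bS k] and [COF_bS k], indexed by [k]. *)

Definition end_cond (k : nat) (M : structure) : Prop :=
  forall (N : structure) (HN : PAminus N) (j : embedding M N),
    elementary j -> prec (Sigma k) (sup_incl j HN).

Definition cof_bS (k : nat) (M : structure) : Prop :=
  forall (N : structure) (HN : PAminus N) (j : embedding M N),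
    elementary j -> prec_bSigmaS k (sup_emb j HN).

Definition COF_bS (k : nat) (M : structure) : Prop :=
  forall (K : structure) (HK : PAminus K) (j : embedding M K),
    prec Delta0 j -> cofinal j -> prec_bSigmaS k j.

(* Main.v *)
(** The leading existential block of a Sigma_{k+1} formula can be bounded
    uniformly on a bounded set of assignments: apply collection to
    [theta(x, y) \/ ~ exists y', theta(x, y')], which needs no hypothesis on
    [x].  Iterating this trick down the hierarchy reduces agreement between [M]
    and a cofinal extension, for bounded-quantifier combinations of Sigma_k
    formulas, to Delta0-elementarity; in an elementary extension the same
    uniform bound gives the witnesses needed for [end_n].

    Conversely, if collection fails at [z0], take an ultrapower [N] of [M] with an
    element above [M].  Choosing for each [m] a tuple [x_m] below [u] with no
    witness below [m] gives a tuple [x] of [sup_N(M)] which, by [end_n], has no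
    witness in [sup_N(M)]; bounding the parameter [z0] by [z0 + 1], the condition
    [cof_{n+2}] brings such an [x] (and some [z]) down to [M]. *)

From mathcomp Require Import all_boot.
From mathcomp Require Import boolp classical_sets filter.
Require Import Defs.

Set Implicit Arguments.
Unset Strict Implicit.
Unset Printing Implicit Defensive.

(** * Renaming of variables and the arithmetical hierarchy *)

Fixpoint rename (V W : Type) (f : V -> W) (phi : formula V) : formula W :=
  match phi with
  | Eq s t => Eq (tmap f s) (tmap f t)
  | Lt s t => Lt (tmap f s) (tmap f t)
  | Not p => Not (rename f p)
  | And p q => And (rename f p) (rename f q)
  | Or p q => Or (rename f p) (rename f q)
  | Imp p q => Imp (rename f p) (rename f q)
  | All p => All (rename (omap f) p)
  | Ex p => Ex (rename (omap f) p)
  end.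

Lemma comp_scons (A B V : Type) (g : A -> B) (a : A) (e : V -> A) :
  g \o scons a e = scons (g a) (g \o e).
Proof. by apply: funext => -[]. Qed.

Lemma comp_scat (A B V W : Type) (g : A -> B) (e : V -> A) (x : W -> A) :
  g \o scat e x = scat (g \o e) (g \o x).
Proof. by apply: funext => -[]. Qed.

Lemma tmap_comp (V W X : Type) (f : V -> W) (g : W -> X) (t : term V) :
  tmap g (tmap f t) = tmap (g \o f) t.
Proof. by elim: t => //= s -> t ->. Qed.

Lemma eval_tmap (M : structure) (V W : Type) (f : V -> W) (t : term V)
    (e : W -> M) : eval e (tmap f t) = eval (e \o f) t.
Proof. by elim: t => //= s -> t ->. Qed.

Lemma eval_emb (M N : structure) (j : embedding M N) (V : Type) (t : term V)
    (e : V -> M) : eval (j \o e) t = j (eval e t).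
Proof.
by elim: t => [|||s IHs t IHt|s IHs t IHt] //=;
  rewrite ?emb_zero ?emb_one ?emb_add ?emb_mul ?IHs ?IHt.
Qed.

Lemma sat_rename (M : structure) (V W : Type) (f : V -> W) (phi : formula V)
    (e : W -> M) : sat (rename f phi) e = sat phi (e \o f).
Proof.
have sconsE X Y (g : X -> Y) (a : M) (d : Y -> M) :
    scons a d \o omap g = scons a (d \o g) by apply: funext => -[].
elim: phi W f e => {}V /=.
- by move=> s t W f e; rewrite !eval_tmap.
- by move=> s t W f e; rewrite !eval_tmap.
- by move=> p IHp W f e; rewrite IHp.
- by move=> p IHp q IHq W f e; rewrite IHp IHq.
- by move=> p IHp q IHq W f e; rewrite IHp IHq.
- by move=> p IHp q IHq W f e; rewrite IHp IHq.
- by move=> p IHp W f e; apply: eq_forall => a; rewrite IHp sconsE.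
- by move=> p IHp W f e; apply: eq_exists => a; rewrite IHp sconsE.
Qed.

Lemma sat_BEx (M : structure) (V : Type) (t : term V) (phi : formula (option V))
    (e : V -> M) :
  sat (BEx t phi) e <-> exists2 a, lt a (eval e t) & sat phi (scons a e).
Proof.
split=> [[a /= []]|[a lt_a phi_a]]; first by rewrite eval_tmap; exists a.
by exists a; rewrite /= eval_tmap.
Qed.

Lemma sat_BAll (M : structure) (V : Type) (t : term V) (phi : formula (option V))
    (e : V -> M) :
  sat (BAll t phi) e <-> forall a, lt a (eval e t) -> sat phi (scons a e).
Proof. by split=> H a; have := H a; rewrite /= eval_tmap. Qed.

Definition renaming_closed (G : fclass) : Prop :=
  forall V W (f : V -> W) phi, G V phi -> G W (rename f phi).

Lemma Delta0_rename : renaming_closed Delta0.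
Proof.
move=> V W f phi D; elim: D W f => {V phi} /=; do ?by constructor; auto.
all: move=> V t phi _ IH W f.
all: have -> : tmap (omap f) (tmap Some t) = tmap Some (tmap f t)
  by rewrite !tmap_comp.
  by apply: Delta0_BAll; apply: IH.
by apply: Delta0_BEx; apply: IH.
Qed.

Scheme Sigma_mut := Minimality for Sigma Sort Prop
  with Pi_mut := Minimality for Pi Sort Prop.
Combined Scheme Sigma_Pi_ind from Sigma_mut, Pi_mut.

Lemma Sigma_Pi_rename :
  (forall n V (phi : formula V), Sigma n phi ->
     forall W (f : V -> W), Sigma n (rename f phi)) /\
  (forall n V (phi : formula V), Pi n phi ->
     forall W (f : V -> W), Pi n (rename f phi)).
Proof.
apply: Sigma_Pi_ind => /=; do ?by constructor; auto.
- by move=> V phi D W f; constructor; apply: Delta0_rename.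
- by move=> V phi D W f; constructor; apply: Delta0_rename.
Qed.

Lemma Sigma_rename n : renaming_closed (Sigma n).
Proof. by move=> V W f phi S; apply: (proj1 Sigma_Pi_rename). Qed.

Lemma Pi_rename n : renaming_closed (Pi n).
Proof. by move=> V W f phi S; apply: (proj2 Sigma_Pi_rename). Qed.

Lemma Sigma_Pi_step :
  (forall n V (phi : formula V), Sigma n phi -> Sigma n.+1 phi) /\
  (forall n V (phi : formula V), Pi n phi -> Pi n.+1 phi).
Proof.
apply: Sigma_Pi_ind.
- by move=> V phi D; apply/Sigma_Pi/Pi_Delta0.
- by move=> n V phi _ P; apply: Sigma_Pi.
- by move=> n V phi _ S; apply: Sigma_Ex.
- by move=> V phi D; apply/Pi_Sigma/Sigma_Delta0.
- by move=> n V phi _ S; apply: Pi_Sigma.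
- by move=> n V phi _ P; apply: Pi_All.
Qed.

Lemma Sigma_leq m n V (phi : formula V) : m <= n -> Sigma m phi -> Sigma n phi.
Proof.
move=> /subnK <-; elim: (n - m) => //= k IHk S.
by rewrite addSn; apply: (proj1 Sigma_Pi_step); apply: IHk.
Qed.

Lemma Pi_leq m n V (phi : formula V) : m <= n -> Pi m phi -> Pi n phi.
Proof.
move=> /subnK <-; elim: (n - m) => //= k IHk S.
by rewrite addSn; apply: (proj2 Sigma_Pi_step); apply: IHk.
Qed.

Lemma Sigma0_Delta0 V (phi : formula V) : Sigma 0 phi -> Delta0 phi.
Proof.
suff inv n : Sigma n phi -> n = 0 -> Delta0 phi by move=> S; apply: (inv 0).
by case.
Qed.

(** * Duals and disjunctions of prenex formulas, up to equivalence *)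

Lemma dual_exists :
  (forall n V (phi : formula V), Sigma n phi -> exists2 psi : formula V, Pi n psi &
     forall (M : structure) (e : V -> M), sat psi e <-> ~ sat phi e) /\
  (forall n V (phi : formula V), Pi n phi -> exists2 psi : formula V, Sigma n psi &
     forall (M : structure) (e : V -> M), sat psi e <-> ~ sat phi e).
Proof.
apply: Sigma_Pi_ind.
(* A literal negation is put only at the [Delta0] matrix; the prefix above it is dualised quantifier
   by quantifier, since [Not] in front of an unbounded quantifier leaves the hierarchy. *)
- by move=> V phi D; exists (Not phi) => //; do 2!constructor.
- by move=> n V phi _ [psi S E]; exists psi => //; constructor.
- move=> n V phi _ [psi S E]; exists (All psi); first by constructor.
  by move=> M e /=; rewrite -forallNP; split=> H a; apply/E.
- by move=> V phi D; exists (Not phi) => //; do 2!constructor.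
- by move=> n V phi _ [psi S E]; exists psi => //; constructor.
- move=> n V phi _ [psi S E]; exists (Ex psi); first by constructor.
  move=> M e /=; rewrite -existsNP.
  by split=> -[a]; exists a; apply/E.
Qed.

Definition Sigma_dual n V phi := proj1 dual_exists n V phi.
Definition Pi_dual n V phi := proj2 dual_exists n V phi.

(** Closure is up to equivalence, because [Or] of two prefixed formulas is not itself in prenex
    form. *)
Definition or_closed (G : fclass) : Prop :=
  forall V (A B : formula V), G V A -> G V B -> exists2 C : formula V, G V C &
    forall (M : structure) (e : V -> M), sat C e <-> sat A e \/ sat B e.

(** The quantifiers of [A] are pulled out first, then those of [B], the other disjunct being renamed
    along [Some]; [orP] joins what remains. *)
Lemma Sigma_or n : or_closed (Pi n) -> or_closed (Sigma n.+1).
Proof.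
move=> orP V A B SA; move: (SA) B; move eq_m: n.+1 SA => m SA.
elim: SA eq_m => {m V A} //.
- move=> m V A PA [eq_m] SA B SB.
  move eq_k: m.+1 SB => k SB; move: eq_k A PA {SA}.
  elim: SB => {k V B} //.
  + move=> k V B PB [eq_k] A PA; case: eq_k PB => <- PB.
    rewrite -eq_m in PA PB.
    have [C PC EC] := orP _ _ _ PA PB; exists C => //.
    by constructor; rewrite -eq_m.
  + move=> k V B _ IH [eq_k] A PA.
    have [C SC EC] := IH (congr1 S eq_k) _ (Pi_rename Some PA).
    exists (Ex C); first by constructor.
    move=> M e /=; split=> [[a /EC]|].
      by rewrite sat_rename => -[]; [left|right; exists a].
    case=> [Ae|[a Ba]]; last by exists a; apply/EC; right.
    (* The new variable does not occur in the disjunct that holds, so any element will do. *)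
    by exists (zero M); apply/EC; left; rewrite sat_rename.
- move=> m V A SA IH [eq_m] _ B SB.
  have [C SC EC] := IH (congr1 S eq_m) SA _ (Sigma_rename Some SB).
  exists (Ex C); first by constructor.
  move=> M e /=; split=> [[a /EC]|].
    by rewrite sat_rename => -[]; [left; exists a|right].
  case=> [[a Aa]|Be]; first by exists a; apply/EC; left.
  by exists (zero M); apply/EC; right; rewrite sat_rename.
Qed.

Lemma Pi_or n : or_closed (Sigma n) -> or_closed (Pi n.+1).
Proof.
move=> orS V A B PA; move: (PA) B; move eq_m: n.+1 PA => m PA.
elim: PA eq_m => {m V A} //.
- move=> m V A SA [eq_m] PA B PB.
  move eq_k: m.+1 PB => k PB; move: eq_k A SA {PA}.
  elim: PB => {k V B} //.
  + move=> k V B SB [eq_k] A SA; case: eq_k SB => <- SB.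
    rewrite -eq_m in SA SB.
    have [C SC EC] := orS _ _ _ SA SB; exists C => //.
    by constructor; rewrite -eq_m.
  + move=> k V B _ IH [eq_k] A SA.
    have [C PC EC] := IH (congr1 S eq_k) _ (Sigma_rename Some SA).
    exists (All C); first by constructor.
    move=> M e /=; split=> [H|].
      (* Pulling a universal quantifier out of a disjunction is classical: if [A] fails, every
         instance must satisfy [B]. *)
      have [Ae|nAe] := EM (sat A e); [by left|right=> a].
      by have /EC[|//] := H a; rewrite sat_rename.
    by case=> H a; apply/EC; [left; rewrite sat_rename|right].
- move=> m V A PA IH [eq_m] _ B PB.
  have [C PC EC] := IH (congr1 S eq_m) PA _ (Pi_rename Some PB).
  exists (All C); first by constructor.
  move=> M e /=; split=> [H|].
    have [Be|nBe] := EM (sat B e); [by right|left=> a].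
    by have /EC[//|] := H a; rewrite sat_rename.
  by case=> H a; apply/EC; [left|right; rewrite sat_rename].
Qed.

Lemma Sigma_Pi_or n : or_closed (Sigma n) /\ or_closed (Pi n).
Proof.
elim: n => [|n [IHS IHP]]; last by split; [apply: Sigma_or|apply: Pi_or].
have or0 V (A B : formula V) (DA : Delta0 A) (DB : Delta0 B) :
  exists2 C, Delta0 C & forall (M : structure) (e : V -> M),
    sat C e <-> sat A e \/ sat B e by exists (Or A B) => //; constructor.
split=> V A B.
  move=> /Sigma0_Delta0 DA /Sigma0_Delta0 DB.
  by have [C DC EC] := or0 _ _ _ DA DB; exists C => //; constructor.
move=> PA PB.
have Pi0_Delta0 (phi : formula V) : Pi 0 phi -> Delta0 phi.
  suff inv n : Pi n phi -> n = 0 -> Delta0 phi by move=> S; apply: (inv 0).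
  by case.
have [C DC EC] := or0 _ _ _ (Pi0_Delta0 _ PA) (Pi0_Delta0 _ PB).
by exists C => //; constructor.
Qed.

(** * Blocks of quantifiers as tuples *)

Definition fcons (A : Type) (b : nat) (c : A) (y : 'I_b -> A) : 'I_b.+1 -> A :=
  fun i => scons c y (unlift ord0 i).

Lemma fcons0 A b c (y : 'I_b -> A) : fcons c y ord0 = c.
Proof. by rewrite /fcons unlift_none. Qed.

Lemma fconsS A b c (y : 'I_b -> A) i : fcons c y (lift ord0 i) = y i.
Proof. by rewrite /fcons liftK. Qed.

Lemma fconsE A b (y : 'I_b.+1 -> A) : y = fcons (y ord0) (y \o lift ord0).
Proof.
by apply: funext => i; case: (unliftP ord0 i) => [k|] ->; rewrite ?fconsS ?fcons0.
Qed.

Lemma fun_ord0 (A : Type) (x y : 'I_0 -> A) : x = y.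
Proof. by apply: funext => -[]. Qed.

(** The head of the tuple becomes the variable [None], so that a single quantifier can bind it;
    [shift_in] is the inverse. *)
Definition shift_out (V : Type) (b : nat) (s : V + 'I_b.+1) : option V + 'I_b :=
  match s with
  | inl v => inl (Some v)
  | inr i => if unlift ord0 i is Some k then inr k else inl None
  end.

Definition shift_in (V : Type) (b : nat) (s : option V + 'I_b) : V + 'I_b.+1 :=
  match s with
  | inl (Some v) => inl v
  | inl None => inr ord0
  | inr k => inr (lift ord0 k)
  end.

Lemma scat_shift_out (A V : Type) b (e : V -> A) c (y : 'I_b -> A) :
  scat (scons c e) y \o @shift_out V b = scat e (fcons c y).
Proof. by apply: funext => -[//|i] /=; rewrite /fcons; case: (unlift _ i). Qed.

Lemma scat_shift_in (A V : Type) b (e : V -> A) c (y : 'I_b -> A) :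
  scat e (fcons c y) \o @shift_in V b = scat (scons c e) y.
Proof. by apply: funext => -[[v|]|k] //=; rewrite ?fcons0 ?fconsS. Qed.


Definition drop_ord0 (V : Type) (s : V + 'I_0) : V :=
  match s with
  | inl v => v
  | inr (Ordinal _ lt0) => False_rect V (notF lt0)
  end.

Lemma comp_drop_ord0 (A V : Type) (e : V -> A) (y : 'I_0 -> A) :
  e \o @drop_ord0 V = scat e y.
Proof. by apply: funext => -[//|[]]. Qed.

Lemma Sigma_ex_tuple n b V (phi : formula (V + 'I_b)) : Sigma n.+1 phi ->
  exists2 psi : formula V, Sigma n.+1 psi & forall (M : structure) (e : V -> M),
    sat psi e <-> exists y, sat phi (scat e y).
Proof.
elim: b V phi => [|b IHb] V phi S.
  exists (rename (@drop_ord0 V) phi); first exact: Sigma_rename.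
  move=> M e; rewrite sat_rename; split=> [H|[y]].
    by exists (fun=> zero M); rewrite -comp_drop_ord0.
  by rewrite -comp_drop_ord0.
have [psi Spsi Epsi] := IHb _ _ (Sigma_rename (@shift_out V b) S).
exists (Ex psi); first by constructor.
move=> M e /=; split=> [[c /Epsi[y]]|[y]].
  by rewrite sat_rename scat_shift_out; exists (fcons c y).
rewrite [y]fconsE => phi_y; exists (y ord0); apply/Epsi; exists (y \o lift ord0).
by rewrite sat_rename scat_shift_out.
Qed.

Lemma Sigma_normal_form n V (phi : formula V) : Sigma n.+1 phi ->
  exists b (theta : formula (V + 'I_b)), Pi n theta /\
    forall (M : structure) (e : V -> M), sat phi e <-> exists y, sat theta (scat e y).
Proof.
move eq_m: n.+1 => m S; elim: S eq_m => {m V phi} //.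
- move=> m V phi P [->]; exists 0, (rename inl phi); split; first exact: Pi_rename.
  move=> M e; split=> [H|[y]]; last by rewrite sat_rename.
  by exists (fun=> zero M); rewrite sat_rename.
- move=> m V phi _ IH /IH[b [theta [P E]]].
  exists b.+1, (rename (@shift_in V b) theta); split; first exact: Pi_rename.
  move=> M e /=; split=> [[c /E[y]]|[y]].
    by exists (fcons c y); rewrite sat_rename scat_shift_in.
  rewrite [y]fconsE sat_rename scat_shift_in => H.
  by exists (y ord0); apply/E; exists (y \o lift ord0).
Qed.

(** * Bounded quantifiers *)

(** Bounds are variables, not terms, so a bounded quantifier never leaves a
    bound common to all the values of the assignment. *)
Inductive bclosure (G : fclass) (V : Type) : formula V -> Prop :=
| bclosure_base phi : G V phi -> bclosure G phi
| bclosure_Not phi : bclosure G phi -> bclosure G (Not phi)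
| bclosure_And phi psi : bclosure G phi -> bclosure G psi -> bclosure G (And phi psi)
| bclosure_BEx v (phi : formula (option V)) :
    bclosure G phi -> bclosure G (BEx (Var v) phi).

Lemma bclosure_rename (G : fclass) : renaming_closed G -> renaming_closed (bclosure G).
Proof.
move=> renG V W f phi B; elim: B W f => {V phi} /=.
- by move=> V phi Gphi W f; apply/bclosure_base/renG.
- by move=> V phi _ IH W f; apply/bclosure_Not/IH.
- by move=> V phi psi _ IHphi _ IHpsi W f; apply: bclosure_And.
- by move=> V v phi _ IH W f; apply: (bclosure_BEx (f v)); apply: IH.
Qed.

Lemma bclosure_Delta0 V (phi : formula V) : bclosure Delta0 phi -> Delta0 phi.
Proof. by elim=> {V phi} *; do ?constructor. Qed.

Lemma bclosure_mono (G H : fclass) V (phi : formula V) :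
  (forall W (psi : formula W), G W psi -> H W psi) -> bclosure G phi -> bclosure H phi.
Proof.
move=> GH; elim=> {V phi} V; do ?by constructor.
by move=> phi /GH; apply: bclosure_base.
Qed.

(** In [psi] the tuple variables hold the bounds [a] in place of the values [y]: [bclosure] admits
    only variables as bounds, so each bound needs one of its own. *)
Lemma bclosure_ex_tuple (G : fclass) b V (phi : formula (V + 'I_b)) :
    renaming_closed G -> bclosure G phi ->
  exists2 psi : formula (V + 'I_b), bclosure G psi &
    forall (M : structure) (e : V -> M) a,
      sat psi (scat e a) <-> exists2 y, tuple_lt y a & sat phi (scat e y).
Proof.
move=> renG; elim: b V phi => [|b IHb] V phi B.
  exists phi => // M e a; split=> [H|[y _]]; last by rewrite (fun_ord0 a y).
  by exists a => // -[].
have [psi Bpsi Epsi] := IHb _ _ (bclosure_rename renG (@shift_out V b) B).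
(* [None] is the head just quantified; the bounds of the tail move up one index, past the bound of
   the head at [inr ord0]. *)
pose r (s : option V + 'I_b) : option (V + 'I_b.+1) :=
  match s with
  | inl o => omap inl o
  | inr k => Some (inr (lift ord0 k))
  end.
exists (BEx (Var (inr ord0)) (rename r psi)).
  by apply/bclosure_BEx/(bclosure_rename renG).
have rE (M : structure) (e : V -> M) a c :
    scons c (scat e a) \o r = scat (scons c e) (a \o lift ord0).
  by apply: funext => -[[]|].
move=> M e a; rewrite sat_BEx /=; split=> [[c lt_c]|[y lt_y]].
  rewrite sat_rename rE => /Epsi[y lt_y].
  rewrite sat_rename scat_shift_out; exists (fcons c y) => // i.
  by case: (unliftP ord0 i) => [k|] ->; rewrite ?fconsS ?fcons0 //; apply: lt_y.
rewrite [y]fconsE => phi_y; exists (y ord0) => //.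
rewrite sat_rename rE; apply/Epsi; exists (y \o lift ord0); first by move=> i; apply: lt_y.
by rewrite sat_rename scat_shift_out.
Qed.

(** Quantifiers extend the type of variables by [option], so tuples indexed by
    ['I_m] are too rigid: it suffices that [V] be a retract of some ['I_m]. *)
Definition finitary (V : Type) : Prop :=
  exists m (f : V -> 'I_m) (g : 'I_m -> V), cancel f g.

Lemma finitary_finType (T : finType) : finitary T.
Proof. by exists #|T|, enum_rank, enum_val; apply: enum_rankK. Qed.

Lemma finitary_option V : finitary V -> finitary (option V).
Proof.
move=> [m [f [g fK]]].
exists m.+1, (fun o => if o is Some v then lift ord0 (f v) else ord0).
exists (fun i => omap g (unlift ord0 i)) => -[v|]; last by rewrite unlift_none.
by rewrite liftK /= fK.
Qed.

(** The block is quantified over ['I_m], where [f] and [g] make every tuple over [V] the restriction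
    of one with the same bound; all the bounds are then identified with the single variable
    [None]. *)
Lemma bclosure_ex_bounded (G : fclass) V W (phi : formula (W + V)) :
    renaming_closed G -> finitary V -> bclosure G phi ->
  exists2 psi : formula (option W), bclosure G psi &
    forall (M : structure) (e : W -> M) u,
      sat psi (scons u e) <-> exists2 x : V -> M, (forall i, lt (x i) u) & sat phi (scat e x).
Proof.
move=> renG [m [f [g fK]]] B.
pose r (s : W + V) : W + 'I_m :=
  match s with inl w => inl w | inr v => inr (f v) end.
have rE (M : structure) (e : W -> M) y : scat e y \o r = scat e (y \o f).
  by apply: funext => -[].
have [psi Bpsi Epsi] := bclosure_ex_tuple renG (bclosure_rename renG r B).
pose r' (s : W + 'I_m) : option W := if s is inl w then Some w else None.
have r'E (M : structure) (e : W -> M) u : scons u e \o r' = scat e (fun=> u).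
  by apply: funext => -[].
exists (rename r' psi); first exact: (bclosure_rename renG).
move=> M e u; rewrite sat_rename r'E Epsi; split=> [[y lt_y]|[x lt_x] Hx].
  by rewrite sat_rename rE; exists (y \o f) => // i; apply: lt_y.
exists (x \o g) => [i|]; first exact: lt_x.
by rewrite sat_rename rE; congr sat: Hx; congr scat; apply: funext => v /=; rewrite fK.
Qed.

(** [chi] says that the leading block has a witness below [None]. It lands in [bclosure (Sigma n)]
    although [theta] is [Pi n], since [theta] is replaced by the negation of its dual. *)
Lemma Sigma_bounded_form n V (phi : formula V) : Sigma n.+1 phi ->
  exists b (theta : formula (V + 'I_b)) (chi : formula (option V)),
    [/\ Pi n theta, bclosure (Sigma n) chi,
        forall (M : structure) (e : V -> M),
          sat phi e <-> exists y, sat theta (scat e y) &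
        forall (M : structure) (e : V -> M) w,
          sat chi (scons w e) <->
            exists2 y : 'I_b -> M, (forall i, lt (y i) w) & sat theta (scat e y)].
Proof.
move=> /Sigma_normal_form[b [theta [P E]]].
have [theta' S E'] := Pi_dual P.
have [||chi B Echi] := @bclosure_ex_bounded _ 'I_b V (Not theta') (@Sigma_rename n).
- exact: finitary_finType.
- exact/bclosure_Not/bclosure_base.
exists b, theta, chi; split=> // M e w; rewrite Echi.
split=> -[y lt_y H]; exists y => //.
  by apply: contrapT => nH; apply: H; apply/E'.
by move=> /E'.
Qed.

(** * Collection and cofinal extensions *)

Lemma PAminus_lt_trans (M : structure) : PAminus M ->
  forall a b c : M, lt a b -> lt b c -> lt a c.
Proof. by move=> PA a b c ab bc; apply: (PAminus_nth PA 7 a b c). Qed.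

Lemma PAminus_lt_total (M : structure) : PAminus M ->
  forall a b : M, lt a b \/ a = b \/ lt b a.
Proof. by move=> PA a b; apply: (PAminus_nth PA 9 a b a). Qed.

Lemma PAminus_lt_succ (M : structure) : PAminus M ->
  forall a : M, lt a (add a (one M)).
Proof.
move=> PA a.
have addC (x y : M) : add x y = add y x by exact: (PAminus_nth PA 1 x y x).
have addr0 : add a (zero M) = a by case: (PAminus_nth PA 5 a a a).
have [lt01 _] := PAminus_nth PA 13 a a a.
have : lt (add (zero M) a) (add (one M) a) by exact: (PAminus_nth PA 10 _ _ a lt01).
by rewrite addC addr0 addC.
Qed.

Lemma PAminus_max (M : structure) : PAminus M ->
  forall a b : M, exists2 c, lt a c & lt b c.
Proof.
move=> PA a b; have [ab|[->|ba]] := PAminus_lt_total PA a b.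
- by exists (add b (one M)); [apply: (PAminus_lt_trans PA ab)|]; apply: PAminus_lt_succ.
- by exists (add b (one M)); apply: PAminus_lt_succ.
- by exists (add a (one M)); [|apply: (PAminus_lt_trans PA ba)]; apply: PAminus_lt_succ.
Qed.

Lemma PAminus_bounded_tuple (M : structure) m : PAminus M ->
  forall e : 'I_m -> M, exists u, forall i, lt (e i) u.
Proof.
move=> PA; elim: m => [|m IHm] x; first by exists (zero M) => -[].
have [u lt_u] := IHm (x \o lift ord0).
have [w lt0 lt_uw] := PAminus_max PA (x ord0) u; exists w => i.
case: (unliftP ord0 i) => [k|] -> //; exact: (PAminus_lt_trans PA (lt_u k)).
Qed.

Lemma PAminus_bounded (M : structure) V : PAminus M -> finitary V ->
  forall e : V -> M, exists u, forall i, lt (e i) u.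
Proof.
move=> PA [m [f [g fK]]] e; have [u lt_u] := PAminus_bounded_tuple PA (e \o g).
by exists u => v; rewrite -(fK v); apply: lt_u.
Qed.

Lemma prec_finitary (G : fclass) (M N : structure) (j : embedding M N) :
    renaming_closed G -> prec G j ->
  forall V (phi : formula V), finitary V -> G V phi ->
  forall e : V -> M, sat phi e <-> sat phi (j \o e).
Proof.
move=> renG P V phi [m [f [g fK]]] Gphi e.
have gf (A : Type) (d : V -> A) : d \o g \o f = d.
  by apply: funext => v /=; rewrite fK.
have := P _ _ (renG _ _ f _ Gphi) (e \o g).
by rewrite !sat_rename gf -[j \o (e \o g)]/(j \o e \o g) gf.
Qed.

(** Allowing every [v] beyond a threshold, rather than giving one bound, lets the thresholds of
    several subformulas be merged into a larger one. *)
Lemma Collminus_uniform (M : structure) n k V (phi : formula V) b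
    (theta : formula (V + 'I_b)) (PA : PAminus M) :
    Collminus (Sigma n.+1) M -> k < n -> finitary V ->
    Sigma k.+1 phi -> Pi k theta ->
    (forall e : V -> M, sat phi e -> exists y, sat theta (scat e y)) ->
  forall u, exists v0, forall v, lt v0 v -> forall e : V -> M, (forall i, lt (e i) u) ->
    sat phi e -> exists2 y : 'I_b -> M, (forall i, lt (y i) v) & sat theta (scat e y).
Proof.
move=> coll lt_kn [m [f [g fK]]] S P E u.
have [psi Ppsi Epsi] := Sigma_dual S.
have [_ orP] := Sigma_Pi_or k.+1.
have [C PC EC] := orP _ _ _ (Pi_leq (leqnSn k) P) (Pi_rename inl Ppsi).
pose r (s : V + 'I_b) : 'I_m + 'I_b :=
  match s with inl w => inl (f w) | inr v => inr v end.
have rE (x : 'I_m -> M) (y : 'I_b -> M) : scat x y \o r = scat (x \o f) y.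
  by apply: funext => -[].
(* The disjunction is [Pi k.+1], hence [Sigma k.+2], which the collection hypothesis covers because
   [k < n]. *)
have SC : Sigma n.+1 (rename r C).
  by apply: (@Sigma_leq k.+2) => //; constructor; apply: Pi_rename.
have [|v coll_v] := coll _ _ _ SC (fun=> u).
  move=> x _; have [/E[y theta_y]|nphi] := EM (sat phi (x \o f)).
    by exists y; rewrite sat_rename rE; apply/EC; left.
  exists (fun=> zero M); rewrite sat_rename rE; apply/EC; right.
  by rewrite sat_rename; apply/Epsi.
have [v0 lt_v0] := PAminus_bounded_tuple PA v; exists v0 => w lt_w e lt_e phi_e.
have [|y [lt_y]] := coll_v (e \o g); first by move=> i; apply: lt_e.
rewrite sat_rename rE (_ : (e \o g) \o f = e); last first.
  by apply: funext => i /=; rewrite fK.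
move=> /EC[theta_y|]; last by rewrite sat_rename => /Epsi.
exists y => // i; apply: (PAminus_lt_trans PA _ lt_w).
exact: (PAminus_lt_trans PA (lt_y i)).
Qed.

Section CofinalExtension.

Variables (M K : structure) (j : embedding M K) (n : nat).
Hypotheses (PAM : PAminus M) (PAK : PAminus K).
Hypotheses (coll : Collminus (Sigma n.+1) M) (cof : cofinal j).

(** Any finitary type of variables is allowed, so that agreement applies to formulas with an extra
    variable for a bound. *)
Definition agree (G : fclass) : Prop :=
  forall V (phi : formula V), finitary V -> G V phi ->
  forall e : V -> M, sat phi e <-> sat phi (j \o e).

(** In [psi] the variable [None] stands for the bound [v] on all leading blocks. *)
Lemma collapse_leading_block k V (phi : formula V) :
    k < n -> agree (bclosure (Sigma k)) -> finitary V -> bclosure (Sigma k.+1) phi ->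
  exists2 psi : formula (option V), bclosure (Sigma k) psi &
    forall u, exists v0, forall v, lt v0 v ->
      (forall e, (forall i, lt (e i) u) -> sat phi e <-> sat psi (scons v e)) /\
      (forall e, (forall i, lt (e i) (j u)) -> sat phi e <-> sat psi (scons (j v) e)).
Proof.
move=> lt_kn agree_k finV B; elim: B finV => {V phi} V.
- move=> phi S finV.
  have [b [theta [chi [P B E Echi]]]] := Sigma_bounded_form S.
  have chi_phi (N : structure) (e : V -> N) w : sat chi (scons w e) -> sat phi e.
    by move=> /Echi[y _ H]; apply/E; exists y.
  have phi_theta (e : V -> M) : sat phi e -> exists y, sat theta (scat e y) by move/E.
  exists chi => // u.
  have [v0 uniform] := Collminus_uniform PAM coll lt_kn finV S P phi_theta u.
  exists v0 => v /uniform{}uniform; split=> e lt_e; split; try exact: chi_phi.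
    by move=> /(uniform _ lt_e)[y lt_y H]; apply/Echi; exists y.
  (* A witness in [K] is below some [j v'].  No assignment below [u] in [M] jumps,
     i.e. satisfies [chi] at [v'] but not at [v], and by [agree_k] neither does
     any in [K]. *)
  pose at_ (c : bool) (o : option V) : bool + V := if o is Some x then inr x else inl c.
  have atE (N : structure) (p : bool -> N) (x : V -> N) c :
      scat p x \o at_ c = scons (p c) x by apply: funext => -[].
  pose jump := And (rename (at_ true) chi) (Not (rename (at_ false) chi)).
  have ren := bclosure_rename (@Sigma_rename k).
  have Bjump : bclosure (Sigma k) jump.
    by apply: bclosure_And; [|apply: bclosure_Not]; apply: ren.
  have [psi Bpsi Epsi] := bclosure_ex_bounded (@Sigma_rename k) finV Bjump.
  move=> /E[y theta_y].
  have [w lt_w] := PAminus_bounded_tuple PAK y.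
  have [v' lt_wv'] := cof w.
  pose p (c : bool) := if c then v' else v.
  have finb : finitary (option bool) by apply/finitary_option/finitary_finType.
  have agree_psi := agree_k _ _ finb Bpsi (scons u p).
  apply: contrapT => nchi.
  have /agree_psi/Epsi[x lt_x] : sat psi (j \o scons u p).
    rewrite comp_scons; apply/Epsi; exists e => //=; rewrite !sat_rename !atE /=.
    split=> //; apply/Echi; exists y => // i; exact: (PAminus_lt_trans PAK (lt_w i)).
  rewrite /= !sat_rename !atE => -[/chi_phi/(uniform _ lt_x)[z lt_z Hz]] [].
  by apply/Echi; exists z.
- move=> phi _ IH finV; have [psi B E] := IH finV.
  exists (Not psi); first exact: bclosure_Not.
  move=> u; have [v0 Ev] := E u; exists v0 => v /Ev[EM' EK].
  by split=> e lt_e /=; [rewrite EM'|rewrite EK].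
- move=> phi1 phi2 _ IH1 _ IH2 finV.
  have [psi1 B1 E1] := IH1 finV; have [psi2 B2 E2] := IH2 finV.
  exists (And psi1 psi2); first exact: bclosure_And.
  move=> u; have [v1 Ev1] := E1 u; have [v2 Ev2] := E2 u.
  have [v0 lt1 lt2] := PAminus_max PAM v1 v2; exists v0 => v lt_v.
  have [EM1 EK1] := Ev1 _ (PAminus_lt_trans PAM lt1 lt_v).
  have [EM2 EK2] := Ev2 _ (PAminus_lt_trans PAM lt2 lt_v).
  by split=> e lt_e /=; [rewrite EM1 // EM2|rewrite EK1 // EK2].
- move=> x phi _ IH finV; have [psi B E] := IH (finitary_option finV).
  (* Under the quantifier [None] is the quantified element and [Some None] the bound [v]; [psi] has
     them the other way round. *)
  pose swap (o : option (option V)) : option (option V) :=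
    match o with
    | None => Some None
    | Some None => None
    | Some (Some i) => Some (Some i)
    end.
  have swapE (A : Type) (a c : A) e :
      scons a (scons c e) \o swap = scons c (scons a e) by apply: funext => -[[]|].
  exists (BEx (Var (Some x)) (rename swap psi)).
    by apply/bclosure_BEx/(bclosure_rename (@Sigma_rename k)).
  move=> u; have [v0 Ev] := E u; exists v0 => v /Ev[EM' EK].
  (* The quantified element lies below [e x], hence below the same [u] as the assignment, so the
     threshold of the body also serves here. *)
  split=> e lt_e; rewrite !sat_BEx /=; split=> -[a lt_a H]; exists a => //; move: H;
    rewrite sat_rename swapE; [move/EM'|move/EM'|move/EK|move/EK]; apply;
    case=> //=; exact: (PAminus_lt_trans _ lt_a).
Qed.

(** Once [u] bounds [e], one [v] in [M] collapses the formula both in [M] and, as [j v], in [K]. The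
    collapsed formula is one level lower, and induction applies with [v] as a further parameter. *)
Lemma Collminus_agree k : prec Delta0 j -> k <= n -> agree (bclosure (Sigma k)).
Proof.
move=> prec0; elim: k => [|k IHk] le_kn V phi finV B e.
  apply: (prec_finitary (@Delta0_rename) prec0) => //.
  by apply/bclosure_Delta0/bclosure_mono/B => W psi /Sigma0_Delta0.
have [psi Bpsi E] := collapse_leading_block le_kn (IHk (ltnW le_kn)) finV B.
have [u lt_u] := PAminus_bounded PAM finV e.
have [v0 Ev] := E u; have [EM' EK] := Ev _ (PAminus_lt_succ PAM v0).
rewrite EM' // EK; last by move=> i; apply: (proj1 (emb_lt j _ _)); apply: lt_u.
by rewrite -comp_scons; apply: IHk => //; [apply: ltnW|apply: finitary_option].
Qed.

(** Failure of [phi] is existential, with matrix [theta]. From [M] to [K]: cofinality bounds a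
    witness of failure in [K] by an element of [M], and agreement on [chi] brings the failure down.
    From [K] to [M]: if [phi] failed at every tuple below [a] in [M], collection would bound the
    witnesses of failure uniformly, and this bounded statement would pass to [K]. *)
Lemma Collminus_prec_bSigma : prec Delta0 j -> prec_bSigmaS n.+1 j.
Proof.
move=> prec0 d phi Pphi a.
have [phi' S E'] := Pi_dual Pphi.
have [b [theta [chi [P B E Echi]]]] := Sigma_bounded_form S.
have agree_n := Collminus_agree prec0 (leqnn n).
have chi_phi' (N : structure) (e : 'I_d -> N) w : sat chi (scons w e) -> sat phi' e.
  by move=> /Echi[y _ H]; apply/E; exists y.
split=> [[x [lt_x phi_x]]|[x [lt_x phi_x]]].
  exists (j \o x); split; first by move=> i; apply: (proj1 (emb_lt j _ _)); apply: lt_x.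
  apply: contrapT => /E'/E[y theta_y].
  have [w lt_w] := PAminus_bounded_tuple PAK y; have [v lt_wv] := cof w.
  have : sat chi (j \o scons v x).
    rewrite comp_scons; apply/Echi; exists y => // i; exact: (PAminus_lt_trans PAK (lt_w i)).
  move=> /agree_n-/(_ (finitary_option (finitary_finType _)) B)/chi_phi'/E'.
  exact.
apply: contrapT => none.
have [|v coll_v] := coll (Sigma_leq (leqnn _) (Sigma_Pi P)) (u := a).
  move=> z lt_z; apply/E/E' => phi_z; apply: none; by exists z.
have [v0 lt_v0] := PAminus_bounded_tuple PAM v.
pose r (o : option 'I_d) : unit + 'I_d := if o is Some i then inr i else inl tt.
have rE (N : structure) (p : N) (z : 'I_d -> N) :
    scat (fun=> p) z \o r = scons p z by apply: funext => -[].
(* [psi] says that some tuple below the bounds violates [chi] at the value of [inl tt]. *)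
have [psi Bpsi Epsi] := bclosure_ex_tuple (@Sigma_rename n)
  (bclosure_rename (@Sigma_rename n) r (bclosure_Not B)).
have finud : finitary (unit + 'I_d) by exact: finitary_finType.
have : sat psi (j \o scat (fun=> v0) a).
  rewrite comp_scat; apply/Epsi; exists x => //.
  rewrite sat_rename (rE _ (j v0)) /= => /chi_phi'/E'; exact.
move=> /agree_n-/(_ finud Bpsi)/Epsi[z lt_z]; rewrite sat_rename rE; apply.
have [y [lt_y theta_y]] := coll_v _ lt_z; apply/Echi; exists y => // i.
exact: (PAminus_lt_trans PAM (lt_y i)).
Qed.

End CofinalExtension.

(** * The supremum of a model in an elementary extension *)

Section Supremum.

Variables (M N : structure) (j : embedding M N) (PAN : PAminus N).

Local Notation K := (sup j PAN).
Local Notation incl := (sup_incl j PAN).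

Lemma sup_initial (a : K) (b : N) : lt b (incl a) -> exists c : K, incl c = b.
Proof.
case: a => a [m le_am] /= lt_ba.
suff sup_b : in_sup j b by exists (exist _ b sup_b).
by exists m; apply: (PAminus_le_trans PAN) le_am; left.
Qed.

(** The supremum is an initial segment of [N], so a quantifier bounded by one of its elements has
    the same range in both structures. *)
Lemma sup_sat_Delta0 V (phi : formula V) (e : V -> K) :
  Delta0 phi -> sat phi e <-> sat phi (incl \o e).
Proof.
move=> D; elim: D e => {V phi} V.
- move=> s t e; rewrite /sat !(eval_emb incl); split=> [->//|]; exact: emb_inj.
- by move=> s t e; rewrite /sat !(eval_emb incl).
- by move=> phi _ IH e /=; rewrite IH.
- by move=> phi psi _ IHphi _ IHpsi e /=; rewrite IHphi IHpsi.
- by move=> phi psi _ IHphi _ IHpsi e /=; rewrite IHphi IHpsi.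
- by move=> phi psi _ IHphi _ IHpsi e /=; rewrite IHphi IHpsi.
- move=> t phi _ IH e; rewrite !sat_BAll (eval_emb incl).
  split=> H a lt_a; last first.
    by apply/IH; rewrite comp_scons; apply: H.
  have [c eq_c] := sup_initial lt_a; rewrite -eq_c -comp_scons; apply/IH/H.
  by rewrite -eq_c in lt_a.
- move=> t phi _ IH e; rewrite !sat_BEx (eval_emb incl).
  split=> -[a lt_a].
    by move/IH; rewrite comp_scons; exists (incl a).
  have [c eq_c] := sup_initial lt_a; rewrite -eq_c -comp_scons => /IH H.
  by exists c => //; rewrite -eq_c in lt_a.
Qed.

Lemma PAminus_sup : PAminus K.
Proof.
move=> phi /=; do 15?[case=> [<- e|]] => //.
(* The subtraction axiom is the only one with a quantifier. From [x + z = y] follows [z <= y], so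
   the difference lies below whatever bounds [y] in [M]. *)
13: {
  move=> /= lt_e.
  have [z eq_z] := PAminus_nth PAN 12 _ _ (incl (e 0)) lt_e.
  rewrite /= in eq_z.
  have sup_z : in_sup j z.
    have [m le_m] := svalP (e 1); exists m.
    apply: (PAminus_le_trans PAN) le_m; rewrite -[sval (e 1)]eq_z.
    have [add0 _] := PAminus_nth PAN 5 z z z.
    have addC := PAminus_nth PAN 1 z (zero N) z.
    rewrite /= in add0 addC; rewrite -{1}add0 addC.
    apply: PAminus_le_add => //; last by right.
    exact: (PAminus_nth PAN 14 (incl (e 0)) z z).
  by exists (exist _ z sup_z); apply: sup_val_inj. }
all: apply/sup_sat_Delta0; first by do ![constructor].
all: by apply: PAN; rewrite /=; do ![by left|right].
Qed.

Lemma sup_emb_Delta0 : elementary j -> prec Delta0 (sup_emb j PAN).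
Proof.
move=> elem d phi D a; rewrite sup_sat_Delta0 //; exact: elem.
Qed.

Lemma sup_emb_cofinal : PAminus M -> cofinal (sup_emb j PAN).
Proof.
move=> PAM [a [m le_am]]; exists (add m (one M)) => /=.
have lt_m := proj1 (emb_lt j _ _) (PAminus_lt_succ PAM m).
by case: le_am => [lt_am|->] //; apply: (PAminus_lt_trans PAN lt_am).
Qed.

End Supremum.

Lemma prec_Pi n (M N : structure) (j : embedding M N) :
  prec (Sigma n) j -> prec (Pi n) j.
Proof.
move=> precS d phi /Pi_dual[phi' S E] a; have := precS d phi' S a.
by rewrite !E => H; split=> phi_a; apply: contrapT => /H; apply.
Qed.

(** By induction on the level. A tuple [e] of the supremum lies below some [u] of [M]; a bound [v]
    in [M] for the leading block, uniform over tuples below [u], is inherited by [N] through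
    elementarity. A witness below [v] lies in the supremum. *)
Lemma Collminus_end_cond (M : structure) n : PAminus M ->
  Collminus (Sigma n.+1) M -> end_cond n M.
Proof.
move=> PAM coll N PAN j elem.
have reflexive : renaming_closed (fun _ _ => True) by [].
suff prec_k k : k <= n -> prec (Sigma k) (sup_incl j PAN) by exact: prec_k (leqnn n).
elim: k => [_|k IHk lt_kn] d phi S e; first exact/sup_sat_Delta0/Sigma0_Delta0.
have [b [theta [chi [P B E Echi]]]] := Sigma_bounded_form S.
have finV : finitary 'I_d by exact: finitary_finType.
have agree_theta (x : 'I_d + 'I_b -> sup j PAN) :
    sat theta x <-> sat theta (sup_incl j PAN \o x).
  apply: (prec_finitary (@Pi_rename k)) => //; last exact: finitary_finType.
  exact/prec_Pi/IHk/ltnW.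
split=> [/E[y]|phi_e].
  by move=> /agree_theta; rewrite comp_scat => H; apply/E; exists (sup_incl j PAN \o y).
have phi_theta (x : 'I_d -> M) : sat phi x -> exists y, sat theta (scat x y) by move/E.
have PAK : PAminus (sup j PAN) by exact: PAminus_sup.
have [c lt_c] := PAminus_bounded PAK finV e.
have [u lt_cu] := @sup_emb_cofinal _ _ j PAN PAM c.
have [v0 uniform] := Collminus_uniform PAM coll lt_kn finV S P phi_theta u.
have {uniform} := uniform _ (PAminus_lt_succ PAM v0); set v := add v0 _ => uniform.
pose r (o : option 'I_d) : unit + 'I_d := if o is Some i then inr i else inl tt.
have rE (A : structure) (p : unit -> A) (z : 'I_d -> A) : scat p z \o r = scons (p tt) z.
  by apply: funext => -[].
(* A tuple escapes if it satisfies [phi] without a witness below the value of [inl tt]. Elementarity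
   carries formulas of every complexity, hence the trivial class below. *)
pose escape : formula (unit + 'I_d) := And (rename inr phi) (Not (rename r chi)).
have [psi _ Epsi] := bclosure_ex_bounded reflexive finV
  (bclosure_base (G := fun _ _ => True) (phi := escape) I).
have fino : finitary (option unit) by apply/finitary_option/finitary_finType.
have := prec_finitary reflexive elem fino (phi := psi) I (scons u (fun=> v)).
rewrite comp_scons !Epsi => elem_escape.
have : ~ exists2 x : 'I_d -> N, (forall i, lt (x i) (j u)) & sat escape (scat (j \o (fun=> v)) x).
  rewrite -elem_escape => -[x lt_x /=]; rewrite !sat_rename rE => -[phi_x []].
    have [y lt_y theta_y] := uniform _ lt_x phi_x.
  by apply/Echi; exists y.
move=> no_escape; apply: contrapT => nphi_e; apply: no_escape.
exists (sup_incl j PAN \o e).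
  by move=> i; apply: (PAminus_lt_trans PAN (lt_c i) lt_cu).
split; first by rewrite sat_rename.
rewrite /= sat_rename rE => /Echi[y lt_y theta_y].
have [y' eq_y] : exists y' : 'I_b -> sup j PAN, y = sup_incl j PAN \o y'.
  have sup_y i : in_sup j (y i) by exists v; left; apply: lt_y.
  by exists (fun i => exist _ (y i) (sup_y i)); apply: funext.
apply: nphi_e; apply/E; exists y'; apply/agree_theta.
by rewrite comp_scat -eq_y.
Qed.

(** * Ultrapowers *)

Section Ultrapower.

Local Open Scope classical_set_scope.

Variables (M : structure) (I : Type) (U : set_system I).
Hypothesis ultraU : UltraFilter U.

Let ultraT (P : I -> Prop) (HP : forall i, P i) : U [set i | P i].
Proof. exact: filterS (fun i _ => HP i) filterT. Qed.

Let ultraI (A B : set I) (UA : U A) (UB : U B) : U (A `&` B).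
Proof. exact: filterI. Qed.

Lemma ultra_not (P : I -> Prop) : U [set i | ~ P i] <-> ~ U [set i | P i].
Proof.
split=> [UnP UP|nUP].
  have /filter_ex[i [] //] : U ([set i | ~ P i] `&` [set i | P i]) by apply: ultraI.
by case: (@in_ultra_setVsetC _ U [set i | P i] ultraU).
Qed.

Lemma ultra_and (P Q : I -> Prop) :
  U [set i | P i /\ Q i] <-> U [set i | P i] /\ U [set i | Q i].
Proof.
split=> [UPQ|[UP UQ]]; last exact: ultraI.
by split; apply: filterS UPQ => i [].
Qed.

Lemma ultra_or (P Q : I -> Prop) :
  U [set i | P i \/ Q i] <-> U [set i | P i] \/ U [set i | Q i].
Proof.
split=> [UPQ|[UP|UQ]]; last 2 first.
- by apply: filterS UP => i; left.
- by apply: filterS UQ => i; right.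
apply: contrapT => /not_orP[/ultra_not UnP /ultra_not UnQ].
have /filter_ex[i [[]]] := ultraI (ultraI UnP UnQ) UPQ.
by move=> nP nQ [].
Qed.

Lemma ultra_imp (P Q : I -> Prop) :
  U [set i | P i -> Q i] <-> (U [set i | P i] -> U [set i | Q i]).
Proof.
split=> [UPQ UP|H]; first by have := ultraI UPQ UP; apply: filterS => i [PQ /PQ].
have [/H UQ|/ultra_not UnP] := EM (U [set i | P i]).
  by apply: filterS UQ => i /=.
by apply: filterS UnP => i /= nPi /nPi.
Qed.

Definition germ (f : I -> M) : (I -> M) -> Prop := fun g => U [set i | f i = g i].

(** Elements are equivalence classes modulo [U], kept as predicates; [repr] picks representatives by
    choice. *)
Definition ultraproduct : Type := {A : (I -> M) -> Prop | exists f, A = germ f}.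

Definition class_of (f : I -> M) : ultraproduct := exist _ (germ f) (ex_intro _ f erefl).

Definition repr (a : ultraproduct) : I -> M := sval (cid (svalP a)).

Lemma repr_germ (a : ultraproduct) : sval a = germ (repr a).
Proof. by rewrite /repr; case: cid. Qed.

Lemma repr_class_of f : U [set i | f i = repr (class_of f) i].
Proof.
rewrite -[U _]/(germ f _) -[germ f]/(sval (class_of f)) repr_germ.
exact: ultraT.
Qed.

Lemma repr_eq (a b : ultraproduct) : a = b <-> U [set i | repr a i = repr b i].
Proof.
split=> [->|Uab]; first exact: ultraT.
suff eq_ab : sval a = sval b.
  case: a b {Uab} eq_ab => [A PA] [B PB] /= eqAB; case: _ / eqAB PB => PB.
  by congr exist; apply: Prop_irrelevance.
rewrite !repr_germ; apply: funext => g; apply: propext.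
by split=> Ug; have := ultraI Uab Ug; apply: filterS => i /= [-> ->].
Qed.

Definition ultrapower : structure := {|
  carrier := ultraproduct;
  zero := class_of (fun=> zero M);
  one := class_of (fun=> one M);
  add a b := class_of (fun i => add (repr a i) (repr b i));
  mul a b := class_of (fun i => mul (repr a i) (repr b i));
  lt a b := U [set i | lt (repr a i) (repr b i)]
|}.

Lemma repr_eval V (t : term V) (e : V -> ultrapower) :
  U [set i | eval (fun v => repr (e v) i) t = repr (eval e t) i].
Proof.
have lift2 (op : M -> M -> M) (f g f' g' : I -> M) :
    U [set i | f i = f' i] -> U [set i | g i = g' i] ->
    U [set i | op (f i) (g i) = repr (class_of (fun i => op (f' i) (g' i))) i].
  move=> Uf Ug; have := repr_class_of (fun i => op (f' i) (g' i)).
  by move=> /(ultraI (ultraI Uf Ug)); apply: filterS => i /= [[-> ->]].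
elim: t => [v|||s IHs t IHt|s IHs t IHt] /=.
- exact: ultraT.
- exact: repr_class_of.
- exact: repr_class_of.
- exact: lift2.
- exact: lift2.
Qed.

(** For the existential quantifier a witness function is chosen index by index; the universal one
    reduces to it through [Not p], since [U] decides every set. *)
Lemma Los V (phi : formula V) (e : V -> ultrapower) :
  sat phi e <-> U [set i | sat phi (fun v => repr (e v) i)].
Proof.
have repr_scons W (a : ultrapower) (d : W -> ultrapower) i :
    (fun v => repr (scons a d v) i) = scons (repr a i) (fun v => repr (d v) i).
  by apply: funext => -[].
have Los_ex W (p : formula (option W)) (d : W -> ultrapower) :
    (forall d : option W -> ultrapower,
       sat p d <-> U [set i | sat p (fun v => repr (d v) i)]) ->
    (exists a, sat p (scons a d)) <->
      U [set i | exists a, sat p (scons a (fun v => repr (d v) i))].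
  move=> IH; split=> [[a /IH]|Up].
    by apply: filterS => i; rewrite /= repr_scons; exists (repr a i).
  have /choice[f Hf] : forall i, exists c : M,
      (exists a, sat p (scons a (fun v => repr (d v) i))) ->
      sat p (scons c (fun v => repr (d v) i)).
    move=> i; have [[a pa]|none] := EM (exists a, sat p (scons a (fun v => repr (d v) i))).
      by exists a.
    (* At an index without a witness any value will do, since [Up] discards such indices. *)
    by exists (zero M).
  exists (class_of f); apply/IH; have := ultraI Up (repr_class_of f).
  by apply: filterS => i /= [/Hf pf eqf]; rewrite repr_scons -eqf.
elim: phi e => {V} V.
- move=> s t e /=; rewrite repr_eq.
  split=> Ust; have := ultraI Ust (ultraI (repr_eval s e) (repr_eval t e));
    apply: filterS => i /=; first by case=> -> [-> ->].
  by case=> + [<- <-].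
- move=> s t e /=.
  split=> Ust; have := ultraI Ust (ultraI (repr_eval s e) (repr_eval t e));
    apply: filterS => i /=; first by case=> + [-> ->].
  by case=> + [<- <-].
- by move=> p IHp e /=; rewrite IHp ultra_not.
- by move=> p IHp q IHq e /=; rewrite IHp IHq ultra_and.
- by move=> p IHp q IHq e /=; rewrite IHp IHq ultra_or.
- by move=> p IHp q IHq e /=; rewrite IHp IHq ultra_imp.
- move=> p IHp e /=.
  have [|ex_U U_ex] := Los_ex _ (Not p) e; first by move=> d /=; rewrite IHp ultra_not.
  split=> [H|H]; apply: contrapT.
    move=> /ultra_not nH; have [|a []] := U_ex; last exact: H.
    by apply: filterS nH => i /= /existsNP.
  move=> /existsNP /ex_U; move: H => /[swap] Uex Uall.
  by have /filter_ex[i [/= + [a]]] := ultraI Uall Uex => /(_ a) pa; apply.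
- by move=> p IHp e /=; apply: Los_ex.
Qed.

Lemma ultrapower_PAminus : PAminus M -> PAminus ultrapower.
Proof.
by move=> PA phi in_phi e; apply/Los; apply: ultraT => i; apply: PA.
Qed.

Lemma class_of_inj f g : class_of f = class_of g -> U [set i | f i = g i].
Proof.
move=> eq_fg; have := ultraI (repr_class_of f) (repr_class_of g).
by rewrite eq_fg; apply: filterS => i /= [-> ->].
Qed.

(** This is [Los] for given representatives instead of the chosen ones. For each variable the two
    agree on a set of [U], and finitely many such sets meet in a set of [U]. *)
Lemma sat_class_of V (phi : formula V) (e : V -> I -> M) : finitary V ->
  @sat ultrapower V phi (fun v => class_of (e v)) <-> U [set i | sat phi (e^~ i)].
Proof.
move=> [m [f [g fK]]]; rewrite Los.
have eq_e : U [set i | forall k : 'I_m, e (g k) i = repr (class_of (e (g k))) i].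
  by apply: filter_forall => k; apply: repr_class_of.
have {}eq_e : U [set i | e^~ i = (fun v => repr (class_of (e v)) i)].
  apply: filterS eq_e => i /= eq_i.
  by apply: funext => v; have := eq_i (f v); rewrite fK.
by split=> H; have := ultraI eq_e H; apply: filterS => i /= [->].
Qed.

Lemma eq_class_of f g : U [set i | f i = g i] -> class_of f = class_of g.
Proof.
move=> Ufg; apply/repr_eq.
have := ultraI Ufg (ultraI (repr_class_of f) (repr_class_of g)).
by apply: filterS => i /= [+ [<- <-]].
Qed.

Lemma repr_const2 (op : M -> M -> M) (a b : M) :
  class_of (fun=> op a b) =
  class_of (fun i => op (repr (class_of (fun=> a)) i) (repr (class_of (fun=> b)) i)).
Proof.
apply: eq_class_of; have := ultraI (repr_class_of (fun=> a)) (repr_class_of (fun=> b)).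
by apply: filterS => i /= [<- <-].
Qed.

Lemma class_of_repr (a : ultraproduct) : class_of (repr a) = a.
Proof.
by apply/repr_eq; apply: filterS (repr_class_of (repr a)) => i /= ->.
Qed.

Lemma class_of_lt (f g : I -> M) :
  @lt ultrapower (class_of f) (class_of g) <-> U [set i | lt (f i) (g i)].
Proof.
have Ufg := ultraI (repr_class_of f) (repr_class_of g).
by split=> lt_fg; have := ultraI Ufg lt_fg; apply: filterS => i /= [[-> ->]].
Qed.

Definition diagonal : embedding M ultrapower.
Proof.
exists (fun a => class_of (fun=> a)) => // [a b|a b|a b|a b].
- by move=> /class_of_inj/filter_ex[].
- exact: repr_const2.
- exact: repr_const2.
- by split=> [lt_ab|/class_of_lt/filter_ex[]//]; apply/class_of_lt/ultraT.
Defined.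

Lemma elementary_diagonal : elementary diagonal.
Proof.
move=> d phi _ a; rewrite (_ : diagonal \o a = fun v => class_of (fun=> a v)) //.
rewrite sat_class_of; last exact: finitary_finType.
by split=> [H|/filter_ex[]//]; apply: ultraT.
Qed.

End Ultrapower.

(** * Collection from the extension conditions *)

Lemma unbounded_ultrafilter (M : structure) : PAminus M ->
  exists2 U : set_system M, UltraFilter U & forall b : M, U (lt b).
Proof.
(* [F] is generated by the final segments. The index set is [M] itself, so modulo [U] the identity
   function represents an element above all of [M]. *)
move=> PA; pose F : set_system M := filter_from setT (@lt M).
have PF : ProperFilter F.
  apply: filter_from_proper; last by move=> b _; exists (add b (one M)); apply: PAminus_lt_succ.
  apply: filter_from_filter; first by exists (zero M).
  move=> a b _ _; have [c ac bc] := PAminus_max PA a b; exists c => // d cd.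
  by split; apply: (PAminus_lt_trans PA _ cd).
have [U [ultraU FU]] := ultraFilterLemma PF.
by exists U => // b; apply: FU; exists b.
Qed.

Lemma end_cof_Colld (M : structure) n : PAminus M ->
  end_cond n M -> cof_bS n.+1 M -> Colld (Sigma n.+1) M.
Proof.
move=> PAM endM cofM a b c phi S u coll z0.
apply: contrapT => nbound.
have [U ultraU Ugt] := unbounded_ultrafilter PAM.
pose N := ultrapower M U; pose j : embedding M N := diagonal M ultraU.
have PAN : PAminus N by exact: ultrapower_PAminus.
have elem_j : elementary j by exact: elementary_diagonal.
have /choice[x Hx] : forall m : M, exists x : 'I_a -> M, tuple_lt x u /\
    forall y : 'I_b -> M, (forall i, lt (y i) m) -> ~ sat phi (scat (scat x y) z0).
  move=> m; apply: contrapT => none; apply: nbound; exists (fun=> m) => x lt_x.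
  apply: contrapT => noney; apply: none; exists x; split=> // y lt_y phi_y.
  by apply: noney; exists y.
pose K := sup j PAN; pose incl := sup_incl j PAN; pose jK := sup_emb j PAN.
pose xN (i : 'I_a) : N := class_of U (fun m => x m i).
have lt_xN i : lt (xN i) (j (u i)).
  by apply/(class_of_lt ultraU); apply: filterS filterT => m _; apply: (Hx m).1.
have [xK eq_xK] : exists xK : 'I_a -> K, xN = incl \o xK.
  have sup_x i : in_sup j (xN i) by exists (u i); left; apply: lt_xN.
  by exists (fun i => exist _ (xN i) (sup_x i)); apply: funext.
(* A witness [y] in the supremum would by [endM] be one in [N], hence at [U]-almost all indices [m].
   But [y] lies below some element of [M], which almost all [m] exceed, so some [x m] would have a
   witness below [m]. *)
have nphiK (y : 'I_b -> K) : ~ sat phi (scat (scat xK y) (jK \o z0)).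
  have [d [theta [P E]]] := Sigma_normal_form S.
  move=> /E[w theta_w].
  pose yN := incl \o y.
  have phiN : sat phi (scat (scat xN yN) (j \o z0)).
    apply/E; exists (incl \o w).
    move: theta_w; rewrite (prec_finitary (@Pi_rename n) (prec_Pi (endM _ PAN j elem_j))) //.
      by rewrite !comp_scat -eq_xK.
    exact: finitary_finType.
  have lt_y : U [set m | forall k, lt (repr (yN k) m) m]%classic.
    apply: filter_forall => k.
    have [v lt_v] := @sup_emb_cofinal _ _ j PAN PAM (y k).
    have lt_yv : U [set m | lt (repr (yN k) m) v]%classic.
      by apply/(class_of_lt ultraU); rewrite class_of_repr.
    by apply: filterS2 lt_yv (Ugt v) => m; apply: (PAminus_lt_trans PAM).
  pose e (s : 'I_a + 'I_b + 'I_c) (m : M) := scat (scat (x m) (fun k => repr (yN k) m)) z0 s.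
  have : U [set m | sat phi (e^~ m)]%classic.
    apply/sat_class_of; first exact: finitary_finType.
    congr sat: phiN; apply: funext => -[[i|k]|l] //=.
    by rewrite class_of_repr.
  move=> phiU; have /filter_ex[m [/= phi_m lt_m]] : U ([set m | sat phi (e^~ m)] `&`
    [set m | forall k, lt (repr (yN k) m) m])%classic by exact: filterI.
  have := (Hx m).2 _ lt_m; apply; congr sat: phi_m.
(* The formula in [cof_bS] has no free variables outside its bounded block, so the parameters [z]
   join [x] in one tuple, and [y] is quantified away. *)
pose r (s : 'I_a + 'I_b + 'I_c) : 'I_(a + c) + 'I_b :=
  match s with
  | inl (inl i) => inl (lshift c i)
  | inl (inr k) => inr k
  | inr l => inl (rshift a l)
  end.
have rE (A : structure) (x' : 'I_(a + c) -> A) (y : 'I_b -> A) :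
    scat x' y \o r = scat (scat (x' \o lshift c) y) (x' \o @rshift a c).
  by apply: funext => -[[]|].
have [psi Spsi Epsi] := Sigma_ex_tuple (Sigma_rename r S).
have [psi' Ppsi' Epsi'] := Sigma_dual Spsi.
pose bound (i : 'I_(a + c)) : M :=
  match split i with inl k => u k | inr l => add (z0 l) (one M) end.
have [_ cof_psi'] := cofM _ PAN j elem_j _ _ Ppsi' bound.
have [|z [lt_z /Epsi'[]]] := cof_psi'.
  exists (fun i => match split i with inl k => xK k | inr l => jK (z0 l) end); split.
    move=> i; rewrite /bound /=; case: (split i) => k.
      by have := lt_xN k; rewrite eq_xK.
    apply: (proj1 (emb_lt jK _ _)); exact: PAminus_lt_succ.
  apply/Epsi'; rewrite Epsi => -[y]; rewrite sat_rename rE.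
  set x' := _ \o lshift c; set z' := _ \o @rshift a c => phi_y.
  have [eq_x' eq_z'] : x' = xK /\ z' = jK \o z0.
    split; apply: funext => i; rewrite /x' /z' /=.
      by rewrite -/(unsplit (inl i)) unsplitK.
    by rewrite -/(unsplit (inr i)) unsplitK.
  by apply: (nphiK y); rewrite -eq_x' -eq_z'.
(* The parameters brought down to [M] may differ from [z0]; the premise of [Colld] speaks of all
   parameters, so it still yields a witness. *)
apply/Epsi; have [|y phi_y] := coll (z \o @rshift a c) (z \o lshift c).
  by move=> i; have := lt_z (lshift c i); rewrite /bound -/(unsplit (inl i)) unsplitK.
by exists y; rewrite sat_rename rE.
Qed.

Theorem theorem6p4 (M : structure) (n : nat) (HM : PAminus M) :
  [<-> Colld (Sigma n.+1) M;
       Collminus (Sigma n.+1) M;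
       end_cond n M /\ COF_bS n.+1 M;
       end_cond n M /\ cof_bS n.+1 M].
Proof.
tfae.
- move=> coll a b phi S u Hu.
  pose r (s : 'I_a + 'I_b) : 'I_a + 'I_b + 'I_0 := inl s.
  have rE x y z : @scat M _ _ (scat x y) z \o r = scat x y by apply: funext.
  (* The parameter tuple is empty, and [fun=> zero M] is its only assignment. *)
  have [|v Hv] := coll a b 0 _ (Sigma_rename r S) u _ (fun=> zero M).
    by move=> z x /Hu[y phi_y]; exists y; rewrite sat_rename rE.
  exists v => x /Hv[y [lt_y]]; rewrite sat_rename rE; by exists y.
- move=> coll; split; first exact: Collminus_end_cond.
  by move=> K PAK j prec0 cof; apply: Collminus_prec_bSigma.
(* The supremum is itself one of the cofinal extensions considered in [COF_bS]. *)
- move=> [endM COF]; split=> // N PAN j elem; apply: COF.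
  + exact: PAminus_sup.
  + exact: sup_emb_Delta0.
  + exact: sup_emb_cofinal.
- by move=> [endM cofM]; apply: end_cof_Colld.
Qed.
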